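(* The category $\mathbf{Co}\text{-}\mathbf{Sob}$ of all co-sober spaces with continuous mappings is not reflective in the category $\mathbf{Top_0}$ of all $T_0$ spaces with continuous mappings.
   Context: The specialization order of a $T_0$ space $X$ is $x\le y$ iff $x\in\mathrm{cl}(\{y\})$; $\uparrow x=\{y\in X: x\le y\}$. A subset of $X$ is saturated if it is the intersection of all open sets containing it (equivalently, an upper set in the specialization order). Let $X$ be a $T_0$ space. A nonempty compact saturated subset $Q$ of $X$ is called $k$-irreducible if for any compact saturated subsets $Q_1,Q_2$ of $X$, $Q=Q_1\cup Q_2$ implies $Q=Q_1$ or $Q=Q_2$. A $T_0$ space $X$ is co-sober if for each $k$-irreducible set $Q$ there is a unique $x\in X$ such that $Q=\uparrow x$. A full subcategory $\mathbf{K}$ of $\mathbf{Top_0}$ is reflective if for each $X\in\mathbf{Top_0}$ there are $X^k\in\mathbf{K}$ and a continuous mapping $\mu_X:X\to X^k$ such that for every continuous mapping $f:X\to Z$ with $Z\in\mathbf{K}$ there is a unique continuous mapping $g:X^k\to Z$ with $g\circ\mu_X=f$. *)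

(* Defs.v *)
From mathcomp Require Import all_boot all_order.
From mathcomp Require Import boolp classical_sets topology.

Set Implicit Arguments.
Unset Strict Implicit.
Unset Printing Implicit Defensive.

Local Open Scope classical_set_scope.

Section CoSober.
Context {T : topologicalType}.
Implicit Types (x y : T) (A Q : set T).

Definition spec_le x y : Prop := closure [set y] x.

Definition up x : set T := [set y | spec_le x y].

Definition saturated A : Prop :=
  A = \bigcap_(U in [set U : set T | open U /\ A `<=` U]) U.

Definition k_irreducible Q : Prop :=
  [/\ Q !=set0, compact Q, saturated Q &
      forall Q1 Q2 : set T,
        compact Q1 -> saturated Q1 -> compact Q2 -> saturated Q2 ->
        Q = Q1 `|` Q2 -> Q = Q1 \/ Q = Q2].

End CoSober.

Definition co_sober (T : topologicalType) : Prop :=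
  kolmogorov_space T /\
  forall Q : set T, k_irreducible Q -> exists! x : T, Q = up x.

(* A full subcategory of Top_0 is given by its class of objects [K], which is
   meant to consist of T_0 spaces; its morphisms are all continuous maps. *)
Definition reflective_in_Top0 (K : topologicalType -> Prop) : Prop :=
  forall X : topologicalType, kolmogorov_space X ->
  exists (Xk : topologicalType) (mu : X -> Xk),
    [/\ K Xk, continuous mu &
        forall (Z : topologicalType) (f : X -> Z), K Z -> continuous f ->
        exists! g : Xk -> Z, continuous g /\ g \o mu = f].

(* Main.v *)
Require Import Defs.
From mathcomp Require Import all_boot all_order.
From mathcomp Require Import boolp classical_sets topology.
From HB Require Import structures.
From mathcomp Require Import cardinality.

Set Implicit Arguments.
Unset Strict Implicit.
Unset Printing Implicit Defensive.

(* Let M be a T1 space in which setT is compact, has at least two points, and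
   is not the union of two proper compact subsets; then setT is k-irreducible
   but not principal.  If mu : M -> Mk were a reflection, then the identity of M
   into the co-sober cofinite topology on the same set would extend to a map g
   on Mk.  A closed set C of M is a fibre of a map from M to a cofinite space
   that is injective outside C.  Comparing g with the extensions of these maps
   shows that g is continuous into M: the Sierpinski space is co-sober, so an
   open set containing the image of mu is all of Mk.  Hence mu would be a
   homeomorphism onto a co-sober space, which is absurd.

   M is built on nat.  Choose a maximal family of pairs (A, l) such that A and
   B have finite intersection whenever (A, l) and (B, m) are in the family with
   l <> m, and let U be open when l in U forces A to be almost contained in U.
   Maximality makes M compact, the finite intersections make compact sets
   closed, and a suitable explicit subfamily makes any two nonempty open sets
   meet. *)

Local Open Scope classical_set_scope.

(** * Two kinds of topology on the natural numbers *)

Definition convergence := set (set nat * nat).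

(* [F (A, l)] prescribes that any enumeration of [A] converges to [l]; a finite
   [A] may have several limits. *)
Definition conv_open (F : convergence) (U : set nat) :=
  forall A l, F (A, l) -> U l -> finite_set (A `\` U).

Definition conv_space (F : convergence) := nat.

HB.instance Definition _ F := Choice.on (conv_space F).

Lemma conv_openT F : conv_open F setT.
Proof. by move=> A l _ _; rewrite setDT. Qed.

Lemma conv_openI F : setI_closed (conv_open F).
Proof.
move=> U V oU oV A l FA [Ul Vl]; rewrite setDIr finite_setU.
by split; [exact: oU FA Ul | exact: oV FA Vl].
Qed.

Lemma conv_open_bigU F (I : Type) (f : I -> set nat) :
  (forall i, conv_open F (f i)) -> conv_open F (\bigcup_i f i).
Proof.
move=> of_ A l FA [i _ fil]; apply: sub_finite_set (of_ i A l FA fil).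
by move=> x [Ax nfx]; split=> // fix_; apply: nfx; exists i.
Qed.

HB.instance Definition _ F := isOpenTopological.Build (conv_space F)
  (@conv_openT F) (@conv_openI F) (@conv_open_bigU F).

(* For [b = true], the point 0 is moreover dense: {0, 1} is then a copy of the
   Sierpinski space. *)
Definition cof_open (b : bool) (U : set nat) :=
  U !=set0 -> finite_set (~` U) /\ (b -> U 0).

Definition cof_space (b : bool) := nat.

HB.instance Definition _ b := Choice.on (cof_space b).

Lemma cof_openT b : cof_open b setT.
Proof. by move=> _; rewrite setCT. Qed.

Lemma cof_openI b : setI_closed (cof_open b).
Proof.
move=> U V oU oV [x [Ux Vx]].
have [fU U0] := oU (ex_intro _ x Ux); have [fV V0] := oV (ex_intro _ x Vx).
by rewrite setCI finite_setU; split=> // tb; split; [exact: U0 | exact: V0].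
Qed.

Lemma cof_open_bigU b (I : Type) (f : I -> set nat) :
  (forall i, cof_open b (f i)) -> cof_open b (\bigcup_i f i).
Proof.
move=> of_ [x [i _ fix_]]; have [fi i0] := of_ i (ex_intro _ x fix_).
split=> [|tb]; last by exists i => //; exact: i0.
by apply: sub_finite_set fi => y nfy fy; apply: nfy; exists i.
Qed.

HB.instance Definition _ b := isOpenTopological.Build (cof_space b)
  (@cof_openT b) (@cof_openI b) (@cof_open_bigU b).

Lemma conv_space_openE F (U : set (conv_space F)) : open U = conv_open F U.
Proof. by []. Qed.

Lemma cof_space_openE b (U : set (cof_space b)) : open U = cof_open b U.
Proof. by []. Qed.

(** * Separated convergence families: the grid and its maximal extension *)

Definition limits_separated (F : convergence) :=
  forall A l B m, F (A, l) -> F (B, m) -> l <> m -> finite_set (A `&` B).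

(** Coding triples by numbers makes every cell (row, column) infinite. Numbers that code no triple
    fall into cell (0, 0), which is harmless. *)
Definition row (x : nat) : nat :=
  if (unpickle x : option (nat * nat * nat)) is Some (t, _, _) then t else 0.

Definition col (x : nat) : nat :=
  if (unpickle x : option (nat * nat * nat)) is Some (_, s, _) then s else 0.

Definition layer (x : nat) : nat :=
  if (unpickle x : option (nat * nat * nat)) is Some (_, _, j) then j else 0.

Lemma infinite_cell (t s : nat) : infinite_set [set x | row x = t /\ col x = s].
Proof.
move=> /(finite_image layer); apply: contra_not infinite_nat.
apply: sub_finite_set => j _.
by exists (pickle (t, s, j)); rewrite /row /col /layer /= pickleK.
Qed.

(* Row [t] converges to [t], and a subset of column [s] that is finite on each
   row converges to [s]. *)
Definition grid : convergence := [set p |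
  p.1 = row @^-1` [set p.2] \/
  (p.1 `<=` col @^-1` [set p.2] /\
   forall t, finite_set (p.1 `&` row @^-1` [set t]))].

Lemma grid_limits_separated : limits_separated grid.
Proof.
have sep_row_col t B m : grid (B, m) -> t <> m ->
    finite_set (row @^-1` [set t] `&` B).
  move=> [/= -> tm|[_ fB] _]; last by rewrite setIC.
  by apply: sub_finite_set (@finite_set0 nat) => x [/= -> /tm].
move=> A l B m [/= ->|[/= sA fA]]; first exact: sep_row_col.
move=> [/= ->|[/= sB _] lm]; first by move=> _; exact: fA.
apply: sub_finite_set (@finite_set0 nat) => x [Ax Bx].
by apply: lm; rewrite -(sA x Ax) -(sB x Bx).
Qed.

Definition fully_convergent (F : convergence) :=
  forall X, infinite_set X -> exists A l, F (A, l) /\ infinite_set (A `&` X).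

Lemma maximal_convergence : exists F : convergence,
  [/\ grid `<=` F, limits_separated F & fully_convergent F].
Proof.
(* Zorn's lemma runs over the families that stay separated after adding [grid], so that the empty
   chain also has its union among them. *)
have [G GP Gtot|F [sF Fmax]] :=
  @Zorn_bigcup _ [set F : convergence | limits_separated (F `|` grid)].
- move=> A l B m [[X GX XA]|gA] [[Y GY YB]|gB].
  + have [XY|YX] := Gtot X Y GX GY.
      by apply: (GP Y GY); left; [exact: XY | ].
    by apply: (GP X GX); left; [ | exact: YX].
  + by apply: (GP X GX); [left | right].
  + by apply: (GP Y GY); [right | left].
  + exact: grid_limits_separated.
exists (F `|` grid); split=> // X Xinf; apply: contrapT => noX.
have finX A l : (F `|` grid) (A, l) -> finite_set (A `&` X).
  by move=> FA; apply: contrapT => infAX; apply: noX; exists A, l.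
(* An infinite [X] almost disjoint from every member could be added with any limit, here 0; by
   maximality it is already a member, so it meets itself in a finite set. *)
have FX : (F `|` [set (X, 0)]) `<=` F.
  apply: contrapT => nFX; apply: (Fmax (F `|` [set (X, 0)])); first by split.
  move=> A l B m [[FA|[-> ->]]|gA] [[FB|[-> ->]]|gB] //.
  + by apply: sF; left.
  + by move=> _; apply: (finX A l); left.
  + by apply: sF; [left | right].
  + by move=> _; rewrite setIC; apply: (finX B m); left.
  + by move=> _; rewrite setIC; apply: (finX B m); right.
  + by apply: sF; [right | left].
  + by move=> _; apply: (finX A l); right.
  + by apply: sF; right.
by apply: Xinf; rewrite -(setIid X); apply: (finX X 0); left; apply: FX; right.
Qed.

(** * Topological properties of convergence spaces *)

Lemma conv_space_closed1 F (x : conv_space F) : closed [set x].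
Proof.
rewrite -openC conv_space_openE => A l _ _; rewrite setDE setCK.
by apply: finite_setIr; exact: finite_set1.
Qed.

Lemma conv_space_kolmogorov F : kolmogorov_space (conv_space F).
Proof.
apply: accessible_kolmogorov => x y /eqP xy; exists (~` [set y]).
rewrite !inE setCK; split=> //.
by rewrite openC; exact: conv_space_closed1.
Qed.

Lemma conv_space_irreducible F (U V : set (conv_space F)) :
  grid `<=` F -> open U -> open V -> U !=set0 -> V !=set0 ->
  U `&` V !=set0.
Proof.
rewrite !conv_space_openE => gF oU oV [t Ut] [s Vs].
have row_U u : U u -> finite_set (row @^-1` [set u] `\` U).
  by move=> Uu; apply: oU Uu; apply: gF; left.
(* Every row indexed by a point of [U] meets [U] in column [s]; one point for
   each of these rows yields a set converging to [s] inside [U]. *)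
have pick_U u : exists x, U u -> [/\ U x, row x = u & col x = s].
  have [Uu|nUu] := pselect (U u); last by exists 0.
  apply: contrapT => nx; apply: (@infinite_cell u s).
  apply: sub_finite_set (row_U u Uu) => x [xu xs]; split=> // Ux.
  by apply: nx; exists x.
have [a aP] := choice pick_U.
have Uinf : infinite_set U.
  move=> Ufin; apply: (@infinite_cell t 0).
  have : finite_set (row @^-1` [set t] `\` U `|` U).
    by rewrite finite_setU; split=> //; exact: row_U.
  apply: sub_finite_set => x [xt _].
  by have [Ux|nUx] := pselect (U x); [right | left].
have aVfin : finite_set (a @` U `\` V).
  apply: oV Vs; apply: gF; right; split=> /= [_ [u Uu <-]|r].
    by have [] := aP u Uu.
  apply: sub_finite_set (finite_set1 (a r)) => _ [[u Uu <-] /= <-].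
  by have [_ -> _] := aP u Uu.
(* If [U] and [V] were disjoint, all the chosen points would lie in the finite set of [aVfin], and
   [row] maps them back onto [U]. *)
apply: contrapT => UV0; apply: Uinf.
apply: sub_finite_set (finite_image row aVfin) => u Uu.
have [Uau rau _] := aP u Uu.
by exists (a u) => //; split=> [|Vau]; [exists u | apply: UV0; exists (a u)].
Qed.

Lemma conv_space_compact F : fully_convergent F ->
  compact [set: conv_space F].
Proof.
move=> Ffull G GG _; apply: contrapT => noclus.
have sep (n : nat) : exists UE : set nat * set nat,
    [/\ conv_open F UE.1, UE.1 n, G UE.2 & UE.1 `&` UE.2 = set0].
  apply: contrapT => nsep; apply: noclus; exists n; split=> //.
  move=> E B GE; rewrite nbhsE => -[U [oU Un] UB].
  apply: contrapT => EB0; apply: nsep; exists (U, E); split=> //=.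
  rewrite -subset0 => x [Ux Ex]; apply: EB0.
  by exists x; split=> //; exact: UB.
have [UE UEP] := choice sep.
have GI n : G [set x | forall i, i <= n -> (UE i).2 x].
  elim: n => [|n IHn].
    have [_ _ G0 _] := UEP 0.
    by apply: filterS G0 => x Ex i; rewrite leqn0 => /eqP ->.
  have [_ _ GS _] := UEP n.+1.
  apply: filterS2 GS IHn => x Ex IH i; rewrite leq_eqVlt => /orP[/eqP ->//|].
  exact: IH.
(* The [y n] avoid the neighborhoods of 0, ..., n, so no infinite subset of
   their range can converge. *)
have [y yP] := choice (fun n => filter_ex (GI n)).
have yU i n : i <= n -> ~ (UE i).1 (y n).
  move=> le_in Uy; have [_ _ _ UE0] := UEP i.
  by have : set0 (y n) by rewrite -UE0; split=> //; exact: yP.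
have fin_y v : finite_set (y @^-1` [set v]).
  apply: sub_finite_set (finite_II v) => n /= ynv; rewrite ltnNge.
  by apply/negP => /yU; apply; rewrite ynv; have [] := UEP v.
have Yinf : infinite_set (range y).
  move=> Yfin; apply: infinite_nat.
  have -> : [set: nat] = \bigcup_(v in range y) y @^-1` [set v].
    by apply/seteqP; split=> // n _; exists (y n) => //; exists n.
  exact: bigcup_finite.
have [A [l [FA AY]]] := Ffull _ Yinf; apply: AY.
(* A point of [A] in the range of [y] is either one of the finitely many outside the neighborhood of
   [l], or some [y n] with [n < l]. *)
have [oU Ul _ _] := UEP l.
have : finite_set ((A `\` (UE l).1) `|` y @` `I_l).
  rewrite finite_setU; split; first exact: oU FA Ul.
  by apply: finite_image; exact: finite_II.
apply: sub_finite_set => x [Ax [n _ ynx]]; rewrite -{}ynx in Ax *.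
have [nl|ln] := ltnP n l; first by right; exists n.
by left; split=> //; exact: yU.
Qed.

Lemma conv_space_compact_closed F (K : set (conv_space F)) :
  limits_separated F -> compact K -> closed K.
Proof.
move=> sepF cK; rewrite -openC conv_space_openE => A l FA nKl.
rewrite setDE setCK.
apply: contrapT => AKinf.
(* A cluster point [k] in [K] of the cofinite filter on [A `&` K] differs from
   [l], so [k] and the complement of [l |` A] form a neighborhood of [k]. *)
pose G := [set E : set (conv_space F) | finite_set ((A `&` K) `\` E)].
have GG : ProperFilter G.
  split; first by rewrite /G /= setD0.
  split; first by rewrite /G /= setDT.
    by move=> E E' GE GE'; rewrite /G /= setDIr finite_setU.
  by move=> E E' EE'; apply: sub_finite_set; exact: setDS.
have GK : G K by rewrite /G /= setDE -setIA setICr setI0.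
have [k [Kk clk]] := cK G GG GK.
have [] : ((A `&` K) `\ k) `&` (~` (l |` A) `|` [set k]) !=set0.
  apply: clk.
    rewrite /G /= setDDr setDv set0U.
    by apply: finite_setIr; exact: finite_set1.
  apply: open_nbhs_nbhs; split; last by right.
  rewrite conv_space_openE => B m FB Um; have lm : l <> m.
    case: Um => [nlA lm|mk lm]; first by apply: nlA; left.
    by apply: nKl; rewrite lm mk.
  (* [B] leaves the neighborhood only at [l] or inside [A], and it meets [A] finitely because its
     limit [m] differs from [l]. *)
  have : finite_set ((A `&` B) `|` [set l]).
    rewrite finite_setU; split; [exact: (sepF A l B m) | exact: finite_set1].
  apply: sub_finite_set => x [Bx nUx]; have [->|Ax] : (l |` A) x.
  - by apply: contrapT => ?; apply: nUx; left.
  - by right.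
  - by left.
by move=> x [[[Ax _] nxk] [nx|xk]]; [apply: nx; right | exact: nxk].
Qed.

Lemma conv_space_compact_cover F (K L : set (conv_space F)) :
  grid `<=` F -> limits_separated F -> compact K -> compact L ->
  K `|` L = setT -> K = setT \/ L = setT.
Proof.
move=> gF sepF cK cL KL; apply: contrapT => /not_orP[KT LT].
have [||||x [nKx nLx]] := @conv_space_irreducible F (~` K) (~` L) gF.
- by rewrite openC; exact: conv_space_compact_closed.
- by rewrite openC; exact: conv_space_compact_closed.
- by apply/set0P/eqP => K0; apply: KT; rewrite -(setCK K) K0 setC0.
- by apply/set0P/eqP => L0; apply: LT; rewrite -(setCK L) L0 setC0.
have : setT x by [].
by rewrite -KL => -[].
Qed.

(** * Saturated sets and co-sobriety of the cofinite spaces *)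

Lemma saturated_open {T : topologicalType} (U : set T) : open U -> saturated U.
Proof.
move=> oU; apply/seteqP; split=> [x Ux V [_ UV]|x]; first exact: UV.
by apply; split.
Qed.

Lemma saturatedI {T : topologicalType} (A B : set T) :
  saturated A -> saturated B -> saturated (A `&` B).
Proof.
move=> sA sB; apply/seteqP; split=> [x ABx V [_]|x ABx]; first exact.
split; [rewrite sA | rewrite sB] => V [oV sV]; apply: ABx; split=> // y [Ay By];
  exact: sV.
Qed.

Lemma up_sub {T : topologicalType} (x : T) (Q : set T) :
  saturated Q -> Q x -> up x `<=` Q.
Proof.
move=> -> Qx y xy U [oU QU].
have [_ [->]] := xy U (open_nbhs_nbhs (conj oU (Qx U (conj oU QU)))).
by [].
Qed.

Lemma saturated_up {T : topologicalType} (x : T) : saturated (up x).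
Proof.
apply/seteqP; split=> [y xy U [_]|y yU B]; first exact.
rewrite nbhsE => -[U [oU Ux] UB]; exists y; split=> //; apply: UB.
by apply: yU; split=> //; apply: up_sub => //; exact: saturated_open.
Qed.

Lemma up_inj {T : topologicalType} (x y : T) :
  kolmogorov_space T -> up x = up y -> x = y.
Proof.
move=> T0 xy; apply: contrapT => /eqP /T0 [A].
have xx z : spec_le z z by exact: subset_closure.
have xley : spec_le x y by have : up x y by rewrite xy; exact: xx.
have ylex : spec_le y x by have : up y x by rewrite -xy; exact: xx.
case=> -[]; rewrite !inE => nA; apply.
  by have [_ [->]] := xley A nA.
by have [_ [->]] := ylex A nA.
Qed.

(** If a point of [A] is not a cluster point, some filter member misses a cofinite set, so the
    filter lives on a finite subset of [A]. *)
Lemma cof_space_compact b (A : set (cof_space b)) : compact A.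
Proof.
move=> G GG GA; have [x Ax] := filter_ex GA.
have [clx|nclx] := pselect (cluster G x); first by exists x.
have [E [U [GE oU Ux EU0]]] : exists E U,
    [/\ G E, open U, U x & E `&` U = set0].
  apply: contrapT => nEU; apply: nclx => E B GE.
  rewrite nbhsE => -[U [oU Ux] UB]; apply: contrapT => EB0; apply: nEU.
  exists E, U; split=> //; rewrite -subset0 => y [Ey Uy]; apply: EB0.
  by exists y; split=> //; exact: UB.
have AEfin : finite_set (A `&` E).
  rewrite cof_space_openE in oU.
  have [Ufin _] := oU (ex_intro _ x Ux); apply: sub_finite_set Ufin.
  by move=> y [_ Ey] Uy; have : set0 y by rewrite -EU0.
have [y [[Ay _] cly]] := finite_compact AEfin GG (filterI GA GE).
by exists y.
Qed.

Lemma cof_space_open_setC1 b (x : cof_space b) : (b -> x <> 0) ->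
  open (~` [set x]).
Proof.
move=> x0; rewrite cof_space_openE => _; rewrite setCK; split.
  exact: finite_set1.
by move=> /x0 /eqP; rewrite eq_sym => /eqP.
Qed.

Lemma cof_space_kolmogorov b : kolmogorov_space (cof_space b).
Proof.
have key (x y : cof_space b) : x <> y -> (b -> x <> 0) ->
    exists A : set (cof_space b), A \in nbhs y /\ x \in ~` A.
  move=> xy x0; exists (~` [set x]); rewrite !inE setCK; split=> //.
  apply: open_nbhs_nbhs; split; first exact: cof_space_open_setC1.
  by move=> yx; apply: xy.
move=> x y /eqP xy; have [x0|x0] := eqVneq x (0 : nat).
  have [||A yA] := key y x; [by move/esym | | by exists A; left].
  by move=> _ y0; apply: xy; rewrite x0 y0.
have [//||A xA] := key x y; [by move=> _; apply/eqP | by exists A; right].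
Qed.

(** All subsets being compact, [Q] splits into [up x] and [Q] minus [x] once the latter is
    saturated. Any nonzero [x] in [Q] will do; failing that, [Q] is the singleton of 0. *)
Lemma cof_space_co_sober b : co_sober (cof_space b).
Proof.
split=> [|Q [[q Qq] _ sQ Qirr]]; first exact: cof_space_kolmogorov.
have [x [Qx sQx]] : exists x, Q x /\ saturated (Q `\ x).
  have [[x [Qx x0]]|Q0] := pselect (exists x, Q x /\ x <> 0).
    exists x; split=> //; apply: saturatedI => //; apply: saturated_open.
    exact: cof_space_open_setC1.
  exists q; split=> //; have -> : Q `\ q = set0.
    rewrite -subset0 => x [Qx xq]; apply: xq => /=.
    have Qz z : Q z -> z = 0.
      by move=> Qz; apply: contrapT => z0; apply: Q0; exists z.
    by rewrite (Qz x Qx) (Qz q Qq).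
  exact/saturated_open/open0.
have [] := Qirr (up x) (Q `\ x) (@cof_space_compact b _) (saturated_up x)
  (@cof_space_compact b _) sQx.
- apply/seteqP; split=> [y Qy|y [xy|[] //]]; last exact: up_sub xy.
  have [->|yx] := pselect (y = x); last by right.
  by left; exact: subset_closure.
- move=> Qup; exists x; split=> // x' Qx'.
  by apply: up_inj; [exact: cof_space_kolmogorov | rewrite -Qup].
- by move=> QQ; move: Qx; rewrite {1}QQ => -[_]; case.
Qed.

(** * Maps out of a reflection *)

Definition reflection_map {X Xk : topologicalType} (mu : X -> Xk) :=
  forall (Z : topologicalType) (f : X -> Z), co_sober Z -> continuous f ->
  exists! g : Xk -> Z, continuous g /\ g \o mu = f.

Section Reflection.
Context {X Xk : topologicalType} {mu : X -> Xk}.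
Hypotheses (mu_cont : continuous mu) (mu_refl : reflection_map mu).

Lemma reflection_eq (Z : topologicalType) (g h : Xk -> Z) : co_sober Z ->
  continuous g -> continuous h -> g \o mu = h \o mu -> g = h.
Proof.
move=> cZ cg ch gh.
have cf : continuous (g \o mu).
  by move=> x; apply: continuous_comp; [exact: mu_cont | exact: cg].
by have [k [_ kuniq]] := mu_refl cZ cf; rewrite -(kuniq g) // -(kuniq h).
Qed.

(** The characteristic map of [W] into the Sierpinski copy, with 0 as open point, agrees with the
    constant 0 on the image of [mu]. *)
Lemma reflection_open_cover (W : set Xk) :
  open W -> (forall x, W (mu x)) -> W = setT.
Proof.
move=> oW Wmu.
pose chi (y : Xk) : cof_space true := if `[< W y >] then 0 else 1.
have chi_cont : continuous chi.
  apply/continuousP => U; rewrite cof_space_openE => oU.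
  have [->|/set0P /oU [_ U0]] := eqVneq U set0; first exact: open0.
  have [U1|nU1] := pselect (U 1).
    have -> : chi @^-1` U = setT; last exact: openT.
    apply/seteqP; split=> // y _; rewrite /chi /=.
    by case: asboolP => // _; exact: U0.
  have -> // : chi @^-1` U = W.
  apply/seteqP; split=> y; rewrite /chi /=; case: asboolP => // _ _.
  exact: U0.
have chi0 : chi = fun=> 0.
  apply: reflection_eq => //; first exact: cof_space_co_sober.
    by move=> y; exact: cvg_cst.
  by apply/funext => x; rewrite /chi /=; case: asboolP.
apply/seteqP; split=> // y _; apply: contrapT => nWy.
by have := congr1 (@^~ y) chi0; rewrite /chi; case: asboolP.
Qed.

End Reflection.

Lemma cof_space_continuous {X : topologicalType} (f : X -> cof_space false) :
  (forall n, closed (f @^-1` [set n])) -> continuous f.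
Proof.
move=> fcl; apply/continuousP => U; rewrite cof_space_openE => oU.
have [->|/set0P /oU [Ufin _]] := eqVneq U set0; first exact: open0.
rewrite -closedC.
have -> : ~` (f @^-1` U) = \bigcup_(n in ~` U) f @^-1` [set n].
  apply/seteqP; split=> [x nUfx|x [n nUn fxn] Ufx]; first by exists (f x).
  by apply: nUn; rewrite -fxn.
by apply: closed_bigcup => // n _.
Qed.

Lemma cof_space_closed1 (n : cof_space false) : closed [set n].
Proof. by rewrite -openC; exact: cof_space_open_setC1. Qed.

(** * The retraction onto the convergence space and the contradiction *)

Lemma reflection_conv_retract F (Xk : topologicalType)
    (mu : conv_space F -> Xk) :
  continuous mu -> reflection_map mu ->
  exists g : Xk -> conv_space F, continuous g /\ g \o mu = id.
Proof.
move=> mu_cont mu_refl.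
have id_cont : continuous (id : conv_space F -> cof_space false).
  by apply: cof_space_continuous => n; exact: conv_space_closed1.
have [g [[g_cont g_mu] _]] := mu_refl _ _ (cof_space_co_sober false) id_cont.
exists g; split=> //; apply/continuousP => U oU.
(* The successor keeps the points of [U] off the fibre over 0, which is thus exactly the complement
   of [U]. *)
pose f (x : conv_space F) : cof_space false := if `[< U x >] then x.+1 else 0.
have f_cont : continuous f.
  apply: cof_space_continuous => -[|n].
    have -> : f @^-1` [set 0] = ~` U; last by rewrite closedC.
    by apply/seteqP; split=> x; rewrite /f /=; case: asboolP.
  have [Un|nUn] := pselect (U n).
    have -> : f @^-1` [set n.+1] = [set n]; last exact: conv_space_closed1.
    apply/seteqP; split=> x; rewrite /f /=; case: asboolP => //.
      by move=> _ [].
      by move=> _ ->.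
    by move=> nUx xn; rewrite xn in nUx.
  have -> : f @^-1` [set n.+1] = set0; last exact: closed0.
  rewrite -subset0 => x; rewrite /f /=; case: asboolP => // Ux [xn].
  by rewrite xn in Ux.
have [h [[h_cont h_mu] _]] := mu_refl _ _ (cof_space_co_sober false) f_cont.
(* Otherwise the closed fibres of [g] and [h] through [y] meet in a closed set disjoint from the
   image of [mu]; its complement is then everything, yet omits [y]. *)
have hE y : h y = f (g y).
  apply: contrapT => hfg.
  have gcl : closed (g @^-1` [set g y]).
    by apply: preimage_closed (@cof_space_closed1 _).
  have hcl : closed (h @^-1` [set h y]).
    by apply: preimage_closed (@cof_space_closed1 _).
  suff WT : ~` (g @^-1` [set g y] `&` h @^-1` [set h y]) = setT.
    by have : setT y by []; rewrite -WT; apply.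
  apply: (reflection_open_cover mu_cont mu_refl).
    by rewrite openC; exact: closedI.
  move=> x [/= gx hx]; apply: hfg.
  rewrite -hx -gx; have /= -> := congr1 (@^~ x) h_mu.
  by have /= -> := congr1 (@^~ x) g_mu.
have -> : g @^-1` U = h @^-1` (~` [set 0]).
  by apply/seteqP; split=> y; rewrite /= hE /f; case: asboolP.
by move/continuousP: h_cont; apply; exact: cof_space_open_setC1.
Qed.

Lemma conv_space_not_reflected F (Xk : topologicalType)
    (mu : conv_space F -> Xk) :
  grid `<=` F -> limits_separated F -> fully_convergent F ->
  co_sober Xk -> continuous mu -> ~ reflection_map mu.
Proof.
move=> gF sepF Ffull cXk mu_cont mu_refl.
have [g [g_cont g_mu]] := reflection_conv_retract mu_cont mu_refl.
have gK x : g (mu x) = x by have := congr1 (@^~ x) g_mu.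
have muK y : mu (g y) = y.
  have : mu \o g = id.
    apply: (reflection_eq mu_cont mu_refl) => //.
      by move=> z; apply: continuous_comp; [exact: g_cont | exact: mu_cont].
      by move=> z; exact: cvg_id.
    by apply/funext => x; rewrite /= gK.
  by move/(congr1 (@^~ y)).
have g_img_compact (K : set Xk) : compact K -> compact (g @` K).
  by apply: continuous_compact; exact: continuous_subspaceT.
have [x [xT _]] : exists! x : Xk, setT = up x.
  apply: cXk.2; split.
  - by exists (mu 0).
  - have -> : setT = mu @` setT by apply/seteqP; split=> // y _; exists (g y).
    apply: continuous_compact; first exact: continuous_subspaceT.
    exact: conv_space_compact.
  - exact/saturated_open/openT.
  - move=> Q1 Q2 cQ1 _ cQ2 _ QT.
    have imT (Q : set Xk) : g @` Q = setT -> setT = Q.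
      move=> gQ; apply/seteqP; split=> // y _.
      have [z Qz gz] : (g @` Q) (g y) by rewrite gQ.
      by rewrite -(muK y) -gz muK.
    have [|||||gQ|gQ] := @conv_space_compact_cover F (g @` Q1) (g @` Q2).
    + exact: gF.
    + exact: sepF.
    + exact: g_img_compact.
    + exact: g_img_compact.
    + by rewrite -image_setU -QT; apply/seteqP; split=> // z _; exists (mu z).
    + by left; exact: imT.
    + by right; exact: imT.
(* As [x] lies in the closure of every [mu n], it belongs to every closed fibre of [g]. *)
have gx n : g x = n.
  have xn : up x (mu n) by rewrite -xT.
  have ncl : closed (g @^-1` [set n]).
    by apply: preimage_closed (@conv_space_closed1 _ _).
  apply: ncl; apply: closure_subset xn => _ ->; exact: gK.
by have := gx 0; rewrite (gx 1).
Qed.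

Theorem corollary3p3 : ~ reflective_in_Top0 co_sober.
Proof.
have [F [gF sepF Ffull]] := maximal_convergence.
move=> /(_ (conv_space F)) []; first exact: conv_space_kolmogorov.
move=> Xk [mu [cXk mu_cont mu_refl]].
exact: conv_space_not_reflected cXk mu_cont mu_refl.
Qed.
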